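(* Let $R$ be an elementary divisor domain and $\mathbb{G}$ its field of fractions. Let $V \subseteq \mathbb{G}^n$ be a $\mathbb{G}$-linear subspace and suppose that the columns of the matrix $Q \in R^{n\times p}$ form a basis of $V$ over $\mathbb{G}$. Then the following are equivalent: 1. The set of the columns of $Q$ is an invertible basis for the $R$-module $V \cap R^n$. 2. For all non-units $r \in R$ and for all $Q' \in R^{n\times p}$ such that $Q \equiv Q' \bmod r$, the matrix $Q'$ has full column rank. 3. The greatest common divisor of all $p \times p$ minors of $Q$ is $1$ (up to multiplication by a unit of $R$). 4. For every $a \in \mathbb{G}^p$, if $b = Qa$ satisfies $b\in R^n$, then $a \in R^p$. 5. $Q$ has trivial Smith form, i.e., a Smith form of $Q$ is $S = \begin{bmatrix} I_p \\ 0 \end{bmatrix} \in R^{n \times p}$.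
   Context: Rings are commutative with unity and $1\neq 0$. A square matrix over $R$ is unimodular if it is invertible over $R$. An integral domain $R$ is an elementary divisor domain if for every matrix $A \in R^{m\times n}$ (all $m,n$) there exist unimodular matrices $U \in R^{m\times m}$, $W \in R^{n\times n}$ and a diagonal (possibly rectangular) matrix $S \in R^{m \times n}$ such that $A = USW$ and the $(i,i)$ element of $S$ divides the $(i+1,i+1)$ element of $S$ for all $i<\min\{m,n\}$. Such an $S$ is called a Smith form of $A$; it is unique up to multiplication of each diagonal element by a unit of $R$. Greatest common divisors exist in $R$ and are defined up to units. Invertible basis: if $M \subseteq R^n$ is a free $R$-module with basis $\mathcal{B}$ (a linearly independent set of generators over $R$), then $\mathcal{B}$ is called an invertible basis if there is a matrix $A \in R^{n\times p}$ whose columns are the elements of $\mathcal{B}$ and which is left invertible over $R$, i.e., there exists $L \in R^{p\times n}$ with $LA = I_p$. For $A,B \in R^{m\times n}$ and $r \in R$, $A \equiv B \bmod r$ means that there exists $D \in R^{m\times n}$ with $A - B = rD$. Full column rank is understood over $\mathbb{G}$ (equivalently, columns linearly independent over $R$). *)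

(* Defs.v *)
From mathcomp Require Import all_boot all_order all_algebra.

Set Implicit Arguments.
Unset Strict Implicit.
Unset Printing Implicit Defensive.

Import GRing.Theory.
Local Open Scope ring_scope.

Definition rdvd (R : comNzRingType) (d x : R) : Prop := exists c, x = c * d.

(* The gcd is determined only up to a unit, hence a relation. *)
Definition is_gcd (R : comNzRingType) (P : R -> Prop) (g : R) : Prop :=
  (forall x, P x -> rdvd g x) /\
  (forall d, (forall x, P x -> rdvd d x) -> rdvd d g).

(* Rows and columns are selected in increasing order. *)
Definition is_minor (R : comNzRingType) (k m n : nat) (A : 'M[R]_(m, n)) (x : R)
    : Prop :=
  exists (f : 'I_k -> 'I_m) (g : 'I_k -> 'I_n),
    [/\ {homo f : i j / (i < j)%N}, {homo g : i j / (i < j)%N}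
      & x = \det (mxsub f g A)].

Definition smith_form (R : comUnitRingType) (m n : nat) (A S : 'M[R]_(m, n))
    : Prop :=
  [/\ is_diag_mx S,
      (forall (i i' : 'I_m) (j j' : 'I_n),
         i = j :> nat -> i' = j' :> nat -> i' = i.+1 :> nat ->
         rdvd (S i j) (S i' j'))
    & exists (U : 'M[R]_m) (W : 'M[R]_n),
        [/\ U \in unitmx, W \in unitmx & A = U *m S *m W]].

Definition elementary_divisor_domain (R : idomainType) : Prop :=
  forall (m n : nat) (A : 'M[R]_(m, n)), exists S, smith_form A S.

Definition columns (R : Type) (n p : nat) (A : 'M[R]_(n, p)) : seq 'cV[R]_n :=
  [seq col j A | j <- enum 'I_p].

(* The second clause says that M is exactly the R-span of B, so M is a
   submodule of R^n. *)
Definition module_basis (R : comNzRingType) (n : nat) (M : {pred 'cV[R]_n})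
    (B : seq 'cV[R]_n) : Prop :=
  (forall c : 'I_(size B) -> R,
     \sum_i c i *: B`_i = 0 -> forall i, c i = 0) /\
  (forall v, v \in M <-> exists c : 'I_(size B) -> R, v = \sum_i c i *: B`_i).

Definition left_invertible (R : comNzRingType) (n p : nat) (A : 'M[R]_(n, p))
    : Prop :=
  exists L : 'M[R]_(p, n), L *m A = 1%:M.

(* The order in which the elements of B are listed is irrelevant. *)
Definition invertible_basis (R : comNzRingType) (n : nat)
    (M : {pred 'cV[R]_n}) (B : seq 'cV[R]_n) : Prop :=
  module_basis M B /\
  exists (p : nat) (A : 'M[R]_(n, p)),
    perm_eq (columns A) B /\ left_invertible A.

Definition congr_mx (R : comNzRingType) (m n : nat) (r : R)
    (A B : 'M[R]_(m, n)) : Prop :=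
  exists D : 'M[R]_(m, n), A - B = r *: D.

Definition tofracmx (R : idomainType) (m n : nat) (A : 'M[R]_(m, n))
    : 'M[{fraction R}]_(m, n) :=
  map_mx (@tofrac R) A.

(* V ∩ R^n, as a predicate on R^n. *)
Definition integral_points (R : idomainType) (n : nat)
    (V : {vspace 'cV[{fraction R}]_n}) : {pred 'cV[R]_n} :=
  [pred v | tofracmx v \in V].

Definition full_column_rank (R : idomainType) (n p : nat) (A : 'M[R]_(n, p))
    : Prop :=
  \rank (tofracmx A) = p.

(* Main.v *)
(** Since Q has full column rank, p <= n and a Smith form gives Q = P T with P
    the first p columns of a unimodular matrix, hence left invertible, and T a
    p x p matrix with det T equal to the product of the Smith diagonal up to a
    unit.  Each of the five conditions amounts to T being unimodular, that is,
    to Q being left invertible. *)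
Require Import Defs.
From mathcomp Require Import all_boot all_order all_algebra all_fingroup.

Set Implicit Arguments.
Unset Strict Implicit.
Unset Printing Implicit Defensive.

Import GRing.Theory.
Local Open Scope ring_scope.

(** * Lists of columns, linear combinations and rank *)

Lemma size_columns (R : Type) (n p : nat) (A : 'M[R]_(n, p)) :
  size (columns A) = p.
Proof. by rewrite size_map size_enum_ord. Qed.

Lemma nth_columns (R : nmodType) (n p : nat) (A : 'M[R]_(n, p)) (j : 'I_p) :
  (columns A)`_j = col j A.
Proof. by rewrite (nth_map j) ?size_enum_ord // nth_ord_enum. Qed.

Lemma mulmx_sum_col (R : comNzRingType) (n p : nat) (A : 'M[R]_(n, p))
    (v : 'cV[R]_p) : A *m v = \sum_j v j 0 *: col j A.
Proof.
apply/colP=> i; rewrite mxE summxE; apply: eq_bigr => j _.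
by rewrite !mxE mulrC.
Qed.

Lemma sum_columns (R : comNzRingType) (n p : nat) (A : 'M[R]_(n, p))
    (c : 'I_(size (columns A)) -> R) :
  \sum_i c i *: (columns A)`_i =
  A *m \col_j c (cast_ord (esym (size_columns A)) j).
Proof.
rewrite mulmx_sum_col (reindex (cast_ord (esym (size_columns A)))) /=; last first.
  by exists (cast_ord (size_columns A)) => i _; rewrite ?cast_ordK ?cast_ordKV.
by apply: eq_bigr => j _; rewrite mxE nth_columns.
Qed.

Lemma mulmx_rank_inj (F : fieldType) (n p q : nat) (A : 'M[F]_(n, p))
    (B : 'M[F]_(p, q)) : \rank A = p -> A *m B = 0 -> B = 0.
Proof.
move=> rkA AB0; have fA : row_free A^T by rewrite /row_free mxrank_tr rkA.
apply: trmx_inj; apply: (row_free_inj fA).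
by rewrite -trmx_mul AB0 !trmx0 mul0mx.
Qed.

Lemma free_columns_rank (F : fieldType) (n p : nat) (A : 'M[F]_(n, p)) :
  free (columns A) -> \rank A = p.
Proof.
move=> /(@freeP _ _ _ [tuple col j A | j < p]) frA.
rewrite -mxrank_tr; apply/eqP; apply: inj_row_free => v vA0.
apply/rowP=> j; rewrite mxE; apply: (frA (v 0)).
rewrite (eq_bigr (fun j => v^T j 0 *: col j A)); last first.
  by move=> i _; rewrite mxE -tnth_nth tnth_mktuple.
by rewrite -mulmx_sum_col -[A]trmxK -trmx_mul vA0 trmx0.
Qed.

Lemma span_columns (F : fieldType) (n p : nat) (A : 'M[F]_(n, p))
    (V : {vspace 'cV[F]_n}) (v : 'cV[F]_n) :
  basis_of V (columns A) -> v \in V <-> exists a, v = A *m a.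
Proof.
move=> bA; split=> [vV | [a ->]].
  exists (\col_j coord [tuple col j A | j < p] j v).
  rewrite mulmx_sum_col {1}(coord_basis (X := [tuple col j A | j < p]) bA vV).
  by apply: eq_bigr => j _; rewrite !mxE -tnth_nth tnth_mktuple.
rewrite mulmx_sum_col; apply: memv_suml => j _; apply: memvZ.
by rewrite (basis_mem bA) //; apply: map_f; rewrite mem_enum.
Qed.

(** * Matrices over the fraction field *)

Section FractionMatrices.
Variable R : idomainType.

Lemma tofracmx_inj (m n : nat) : injective (@tofracmx R m n).
Proof.
move=> A B /matrixP eqAB; apply/matrixP=> i j.
by move: (eqAB i j); rewrite !mxE => /eqP; rewrite tofrac_eq => /eqP.
Qed.

Lemma tofracmxM (m n p : nat) (A : 'M[R]_(m, n)) (B : 'M[R]_(n, p)) :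
  tofracmx (A *m B) = tofracmx A *m tofracmx B.
Proof. exact: map_mxM. Qed.

Lemma full_column_rank_inj (n p q : nat) (A : 'M[R]_(n, p))
    (B : 'M[R]_(p, q)) : full_column_rank A -> A *m B = 0 -> B = 0.
Proof.
move=> rkA AB0; apply: tofracmx_inj; rewrite /tofracmx map_mx0.
by apply: mulmx_rank_inj rkA _; rewrite -tofracmxM AB0 /tofracmx map_mx0.
Qed.

(** A nonzero determinant is a unit over the fraction field, so [L *m A] has rank [p] there, and
    this rank is at most that of [A]. *)
Lemma full_column_rank_det_mulmx (n p : nat) (L : 'M[R]_(p, n))
    (A : 'M[R]_(n, p)) : \det (L *m A) != 0 -> full_column_rank A.
Proof.
move=> nzLA; apply/eqP; rewrite eqn_leq rank_leq_col /=.
have uLA : tofracmx (L *m A) \in unitmx.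
  by rewrite unitmxE det_map_mx unitfE tofrac_eq0.
by rewrite -{1}(mxrank_unit uLA) tofracmxM mxrankM_maxr.
Qed.

End FractionMatrices.

(** * Minors, divisibility and determinants *)

(** Sorting the values of [f] yields [s], and injectivity makes the order strict. This links
    arbitrary row selections to the increasing ones in [is_minor]. *)
Lemma increasing_reorder (n p : nat) (f : 'I_p -> 'I_n) : injective f ->
  exists (s : {perm 'I_p}), {homo f \o s : i j / (i < j)%N}.
Proof.
move=> inj_f; pose t := [tuple f i | i < p].
pose r := relpre (@nat_of_ord n) leq.
have /tuple_permP[s def_s] : perm_eq (sort r t) t by rewrite perm_sort.
exists s => i j lt_ij; rewrite ltn_neqAle; apply/andP; split.
  apply: contraTneq lt_ij => /= /val_inj/inj_f/perm_inj->.
  by rewrite ltnn.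
have r_trans : transitive r by move=> x y z; apply: leq_trans.
have r_total : total r by move=> x y; apply: leq_total.
have := sorted_ltn_nth r_trans (f i) (sort_sorted r_total t).
have nth_f (k : 'I_p) : nth (f i) (sort r t) k = f (s k).
  by rewrite def_s -tnth_nth !tnth_mktuple.
by move/(_ i j); rewrite !inE size_sort size_tuple !ltn_ord !nth_f; apply.
Qed.

Section MinorDivisibility.
Variable R : comNzRingType.

Lemma rdvd_sum (I : finType) (d : R) (F : I -> R) :
  (forall i, rdvd d (F i)) -> rdvd d (\sum_i F i).
Proof.
move=> dF; apply: big_ind => //; first by exists 0; rewrite mul0r.
by move=> _ _ [a ->] [b ->]; exists (a + b); rewrite mulrDl.
Qed.

Lemma rdvd_mull (d x a : R) : rdvd d x -> rdvd d (a * x).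
Proof. by move=> [c ->]; exists (a * c); rewrite mulrA. Qed.

(** The Cauchy-Binet expansion before grouping: distributing the products of entries over their sums
    gives one term for each map [f], injective or not. *)
Lemma det_mulmx_rowsub (n p : nat) (A : 'M[R]_(p, n)) (B : 'M[R]_(n, p)) :
  \det (A *m B) =
  \sum_(f : {ffun 'I_p -> 'I_n}) (\prod_i A i (f i)) * \det (rowsub f B).
Proof.
rewrite /determinant; under eq_bigr => s _ do
  [under eq_bigr do rewrite mxE; rewrite bigA_distr_bigA big_distrr /=].
rewrite exchange_big; apply: eq_bigr => f _; rewrite big_distrr.
apply: eq_bigr => s _; rewrite big_split mulrCA; congr (_ * (_ * _)).
by apply: eq_bigr => i _; rewrite mxE.
Qed.

(** For injective [f], sorting the selected rows gives a genuine minor and costs only a sign;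
    otherwise two rows coincide and the determinant is 0. *)
Lemma rdvd_det_rowsub (n p : nat) (B : 'M[R]_(n, p)) (d : R) (f : 'I_p -> 'I_n) :
  (forall x, is_minor p B x -> rdvd d x) -> rdvd d (\det (rowsub f B)).
Proof.
move=> dB; have [/injectiveP inj_f | /injectivePn[i [j ij fij]]] := boolP (injectiveb f).
  have [s incr] := increasing_reorder inj_f.
  have /dB[c] : is_minor p B (\det (rowsub (f \o s) B)) by exists (f \o s), id; split.
  rewrite rowsub_comp -row_permEsub row_permE det_mulmx det_perm => defc.
  by exists ((-1) ^+ s * c); rewrite -mulrA -defc signrMK.
rewrite (determinant_alternate ij) => [|k]; first by exists 0; rewrite mul0r.
by rewrite !mxE fij.
Qed.

Lemma rdvd_det_mulmx (n p : nat) (A : 'M[R]_(p, n)) (B : 'M[R]_(n, p)) (d : R) :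
  (forall x, is_minor p B x -> rdvd d x) -> rdvd d (\det (A *m B)).
Proof.
move=> dB; rewrite det_mulmx_rowsub; apply: rdvd_sum => f.
exact/rdvd_mull/rdvd_det_rowsub.
Qed.

Lemma minor_mulmx (n p : nat) (P : 'M[R]_(n, p)) (T : 'M[R]_p) (x : R) :
  is_minor p (P *m T) x -> rdvd (\det T) x.
Proof.
(* The inserted identity matrix absorbs the column selection [g], which then contributes only a
   determinant factor. *)
case=> f [g [_ _ ->]]; rewrite -[T]mulmx1 mulmxA mxsub_mul mulmx1.
have -> : rowsub f (P *m T) = rowsub f P *m T by rewrite -mul_rowsub_mx.
exists (\det (rowsub f P) * \det (colsub g 1%:M)).
by rewrite !det_mulmx mulrAC.
Qed.

End MinorDivisibility.

(** The determinant is a polynomial in [r] with constant term 1. [N] is the matrix with [r] replaced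
    by the indeterminate, and 0 is a root of [\det N - 1]. *)
Lemma det_1_sub_scale (R : comNzRingType) (n : nat) (r : R) (M : 'M[R]_n) :
  exists c, \det (1%:M - r *: M) = 1 - c * r.
Proof.
pose N := 1%:M - 'X *: map_mx polyC M.
have detN a : (\det N).[a] = \det (1%:M - a *: M).
  rewrite -[LHS]/(horner_eval a _) -det_map_mx; congr (\det _).
  by apply/matrixP=> i j; rewrite !mxE /= /horner_eval hornerD hornerN hornerMn !hornerE.
have /factor_theorem[q def_q] : root (\det N - 1) 0.
  by rewrite rootE !hornerE detN scale0r subr0 det1 subrr.
exists (- q.[r]); rewrite -detN -[\det N](subrK 1) def_q.
by rewrite !hornerE subr0 mulNr opprK addrC.
Qed.

(** * Factorizations from Smith forms *)

Section SmithForm.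
Variable R : idomainType.

(** As [p <= n], the Smith form is [pid_mx p *m diag_mx s] with [s] its diagonal. This isolates the
    square factor [T = diag_mx s *m W], to the right of the left invertible [U *m pid_mx p]. *)
Lemma smith_factorization (n p : nat) (A : 'M[R]_(n, p)) :
  elementary_divisor_domain R -> (p <= n)%N ->
  exists (U : 'M[R]_n) (s : 'rV[R]_p) (W : 'M[R]_p),
    [/\ U \in unitmx, W \in unitmx & A = U *m pid_mx p *m (diag_mx s *m W)].
Proof.
move=> /(_ n p A)[S [/is_diag_mxP diagS _ [U [W [uU uW ->]]]]] le_pn.
exists U, (\row_j S (widen_ord le_pn j) j), W; split=> //.
rewrite mulmxA -(mulmxA U _ (diag_mx _)); congr (U *m _ *m W).
apply/matrixP=> i j; rewrite mul_mx_diag !mxE.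
have [eq_ij | neq_ij] := eqVneq (i : nat) j; last by rewrite diagS // mul0r.
rewrite eq_ij ltn_ord mul1r; congr (S _ j); exact: val_inj.
Qed.

Lemma smith_form_pid (n p : nat) (U : 'M[R]_n) (T : 'M[R]_p) :
  U \in unitmx -> T \in unitmx ->
  smith_form (U *m pid_mx p *m T) (pid_mx p : 'M_(n, p)).
Proof.
move=> uU uT; split; last by exists U, T.
  by apply/is_diag_mxP=> i j /negPf neq_ij; rewrite mxE neq_ij.
move=> i i' j j' eq_ij eq_ij' _; exists (pid_mx p i' j').
by rewrite [pid_mx p i j]mxE eq_ij eqxx ltn_ord mulr1.
Qed.

Lemma pid_mx_factor_left_invertible (n p : nat) (U : 'M[R]_n) (T : 'M[R]_p) :
  (p <= n)%N -> U \in unitmx -> T \in unitmx ->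
  left_invertible (U *m (pid_mx p : 'M_(n, p)) *m T).
Proof.
move=> le_pn uU uT; exists (invmx T *m pid_mx p *m invmx U).
by rewrite -!mulmxA mulKmx // (mulmxA _ _ T) pid_mx_id // pid_mx_1 mul1mx mulVmx.
Qed.

(* If the i-th diagonal entry is a non-unit r, zeroing it changes A by a multiple
   of r and destroys full column rank. *)
Lemma congr_full_rank_unit (n p : nat) (P : 'M[R]_(n, p)) (s : 'rV[R]_p)
    (W : 'M[R]_p) : W \in unitmx ->
  (forall r : R, r \isn't a GRing.unit -> forall A : 'M[R]_(n, p),
     congr_mx r (P *m (diag_mx s *m W)) A -> full_column_rank A) ->
  diag_mx s *m W \in unitmx.
Proof.
move=> uW frk; rewrite unitmx_mul uW andbT unitmxE det_diag.
apply: rpred_prod => i _; apply/negPn/negP => /frk{}frk.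
pose s' := \row_j (if j == i then 0 else s 0 j).
(* The kernel vector is the preimage under [W] of the [i]-th standard vector. The altered matrix
   kills it, so full rank would force it to be 0. *)
have /frk/(full_column_rank_inj (B := invmx W *m delta_mx i (0 : 'I_1))) :
    congr_mx (s 0 i) (P *m (diag_mx s *m W)) (P *m (diag_mx s' *m W)).
  exists (P *m (delta_mx i i *m W)).
  rewrite -mulmxBr -mulmxBl scalemxAr scalemxAl; congr (_ *m (_ *m _)).
  apply/matrixP=> j k; rewrite !mxE; have [<-|nejk] := eqVneq j k.
    rewrite !mulr1n andbb.
    by case: eqVneq => [->|_]; rewrite ?mulr1 ?subr0 ?mulr0 ?subrr.
  rewrite !mulr0n subr0; case: eqVneq => //= [eji|_]; last by rewrite mulr0.
  by rewrite -eji eq_sym (negPf nejk) mulr0.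
have -> : P *m (diag_mx s' *m W) *m (invmx W *m delta_mx i (0 : 'I_1)) = 0.
  rewrite -!mulmxA (mulmxA W) mulmxV // mul1mx mul_diag_mx.
  suff -> : \matrix_(j, k) (s' 0 j * delta_mx i (0 : 'I_1) j k) = 0 by rewrite mulmx0.
  apply/matrixP=> j k; rewrite !mxE; case: eqP => //= _; rewrite ?mul0r ?mulr0 //.
move=> /(_ erefl)/(congr1 (mulmx W)); rewrite mulmxA mulmxV // mul1mx mulmx0.
by move/matrixP/(_ i 0)/eqP; rewrite !mxE !eqxx oner_eq0.
Qed.

End SmithForm.

(** * Invertible bases and the equivalence *)

Lemma perm_columns_left_invertible (R : comNzRingType) (n p q : nat)
    (A : 'M[R]_(n, q)) (B : 'M[R]_(n, p)) :
  perm_eq (columns A) (columns B) -> left_invertible A -> left_invertible B.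
Proof.
move=> pAB; have eq_qp : q = p.
  by rewrite -(size_columns A) -(size_columns B); apply: perm_size.
subst q; have /(@tuple_permP _ _ _ [tuple col j B | j < p])[s defA] := pAB.
have -> : A = B *m perm_mx s^-1.
  rewrite -col_permE; apply/matrixP=> i j; rewrite mxE.
  have := congr1 (fun X : seq 'cV[R]_n => X`_j i 0) defA.
  by rewrite nth_columns -tnth_nth !tnth_mktuple !mxE.
(* [L *m B] and the permutation matrix are square, so their product being 1 lets the permutation
   move to the left of [L]. *)
case=> L; rewrite mulmxA => /mulmx1C; rewrite mulmxA => LB1.
by exists (perm_mx s^-1 *m L).
Qed.

(** The left inverse reads off coordinates: if [v = Q a] over the fraction field, then [a = L v],
    which is integral when [v] is. *)
Lemma left_invertible_basis (R : idomainType) (n p : nat)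
    (V : {vspace 'cV[{fraction R}]_n}) (Q : 'M[R]_(n, p)) :
  basis_of V (columns (tofracmx Q)) -> left_invertible Q ->
  invertible_basis (integral_points V) (columns Q).
Proof.
move=> hQ [L LQ1]; split; last by exists p, Q; split=> //; exists L.
split=> [c | v].
  rewrite sum_columns => /(congr1 (mulmx L)); rewrite mulmxA LQ1 mul1mx mulmx0.
  move=> /colP c0 i; have := c0 (cast_ord (size_columns Q) i).
  by rewrite !mxE cast_ordK.
split=> [/(span_columns _ hQ)[a def_v] | [c ->]]; last first.
  rewrite sum_columns; apply/(span_columns _ hQ).
  by rewrite tofracmxM; eexists.
exists (fun i => (L *m v) (cast_ord (size_columns Q) i) 0); rewrite sum_columns.
have -> : \col_j (L *m v) (cast_ord (size_columns Q)
            (cast_ord (esym (size_columns Q)) j)) 0 = L *m v.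
  by apply/colP=> j; rewrite mxE cast_ordKV.
apply: tofracmx_inj; rewrite !tofracmxM def_v.
rewrite [tofracmx L *m _]mulmxA -tofracmxM LQ1.
by rewrite /tofracmx map_mx1 mul1mx.
Qed.

Theorem theorem3p10 (R : idomainType) (hR : elementary_divisor_domain R)
    (n p : nat) (V : {vspace 'cV[{fraction R}]_n}) (Q : 'M[R]_(n, p))
    (hQ : basis_of V (columns (tofracmx Q))) :
  [<-> invertible_basis (integral_points V) (columns Q);
       forall r : R, r \isn't a GRing.unit ->
         forall Q' : 'M[R]_(n, p), congr_mx r Q Q' -> full_column_rank Q';
       is_gcd (is_minor p Q) 1;
       forall (a : 'cV[{fraction R}]_p) (b : 'cV[R]_n),
         tofracmx b = tofracmx Q *m a ->
         exists a' : 'cV[R]_p, a = tofracmx a';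
       smith_form Q (pid_mx p)].
Proof.
have rkQ : \rank (tofracmx Q) = p by apply/free_columns_rank/(basis_free hQ).
have le_pn : (p <= n)%N by rewrite -rkQ rank_leq_row.
have [U [s [W [uU uW defQ]]]] := smith_factorization Q hR le_pn.
tfae.
(* With [Q' = Q - r D], [\det (L *m Q')] has the form [1 - c * r]; if it vanished, [r] would be a
   unit. *)
- case=> _ [q [A [/perm_columns_left_invertible pAQ /pAQ[L LQ1]]]] r nur Q' [D defD].
  apply: (full_column_rank_det_mulmx (L := L)); apply: contra nur => /eqP det0.
  have def_Q' : L *m Q' = 1%:M - r *: (L *m D).
    by rewrite -LQ1 scalemxAr -mulmxBr -defD subKr.
  have [c] := det_1_sub_scale r (L *m D); rewrite -def_Q' det0 => eq0.
  by apply/unitrPr; exists c; rewrite mulrC; apply/esym/eqP; rewrite -subr_eq0 -eq0.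
- move=> frk; rewrite defQ in frk *; have uT := congr_full_rank_unit uW frk.
  split=> [x _ | d dQ]; first by exists x; rewrite mulr1.
  have [L LQ1] := pid_mx_factor_left_invertible le_pn uU uT.
  (* Here [1 = \det (L *m Q)] is a combination of maximal minors of [Q], so every common divisor of
     them divides 1. *)
  by rewrite -(det1 _ p) -LQ1; apply: rdvd_det_mulmx.
- case=> _ gcd1 a b def_b.
  (* [\det T] divides every maximal minor of [Q], hence 1. So [T] is unimodular and a left inverse
     of [Q] recovers [a] from [b]. *)
  have [|c c1] := gcd1 (\det (diag_mx s *m W)).
    by move=> x; rewrite {1}defQ; apply: minor_mulmx.
  have uT : diag_mx s *m W \in unitmx.
    by rewrite unitmxE; apply/unitrPr; exists c; rewrite mulrC.
  have [L LQ1] := pid_mx_factor_left_invertible le_pn uU uT.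
  exists (L *m b); rewrite tofracmxM def_b mulmxA -tofracmxM defQ LQ1.
  by rewrite /tofracmx map_mx1 mul1mx.
- move=> int_sol; pose T := diag_mx s *m W.
  have uF : tofracmx T \in unitmx.
    rewrite -row_full_unit /row_full eqn_leq rank_leq_col -{1}rkQ defQ tofracmxM.
    exact: mxrankM_maxr.
  (* [Q] sends column [j] of the inverse of [T] to column [j] of [U *m pid_mx p], which is integral.
     Hence that inverse has entries in [R]. *)
  have int_col (j : 'I_p) : exists x : 'cV[R]_p, col j (invmx (tofracmx T)) = tofracmx x.
    apply: (int_sol _ (col j (U *m pid_mx p))).
    rewrite defQ tofracmxM -mulmxA -/T [col j (invmx _)]colE mulKVmx // /tofracmx.
    by rewrite map_col colE.
  have [x def_x] := fin_all_exists int_col.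
  have TX1 : T *m \matrix_(i, j) x j i 0 = 1%:M.
    apply: tofracmx_inj; rewrite tofracmxM.
    have -> : tofracmx (\matrix_(i, j) x j i 0) = invmx (tofracmx T).
      by apply/matrixP=> i j; move/colP/(_ i): (def_x j); rewrite !mxE.
    by rewrite mulmxV // /tofracmx map_mx1.
  by rewrite {1}defQ; apply: smith_form_pid => //; case: (mulmx1_unit TX1).
- case=> _ _ [U' [W' [uU' uW' defQ']]]; apply: left_invertible_basis => //.
  by rewrite defQ'; apply: pid_mx_factor_left_invertible.
Qed.
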